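(* Let $H$ and $V$ be linear operators on a complex vector space $\mathcal V$, let $A=H+V$ and $b\in\mathcal V$, and let $\alpha_k,\beta_k\in\mathbb C$ ($k\in\mathbb N$) be parameters with $\alpha_k+\beta_k\neq 0$ such that $H+\alpha_kI$ and $V+\beta_kI$ are invertible. Assume that $H$ and $V$ commute, i.e. $HV=VH$. Then the ADI method for $Ax=b$ with these parameters is a fully commuting splitting scheme: its iterates satisfy $M_kx^{k+1}=N_kx^k+b$ with $$M_k=(\alpha_k+\beta_k)^{-1}(H+\alpha_kI)(V+\beta_kI),\qquad N_k=(\alpha_k+\beta_k)^{-1}(H-\beta_kI)(V-\alpha_kI),$$ where $A=M_k-N_k$ for all $k\in\mathbb N$, and for all $i,j\in\mathbb N$ one has $M_iN_j=N_jM_i$, $M_iM_j=M_jM_i$ and $N_iN_j=N_jN_i$.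
   Context: The ADI (alternating-direction implicit) method for $Ax=b$ with $A=H+V$ and parameters $\alpha_k,\beta_k\in\mathbb C$ is, starting from $x^0\in\mathcal V$, the iteration $$(H+\alpha_kI)\,x^{k+1/2}=b-(V-\alpha_kI)\,x^k,\qquad (V+\beta_kI)\,x^{k+1}=b-(H-\beta_kI)\,x^{k+1/2},\qquad k\in\mathbb N.$$ A nonstationary splitting scheme for $Ax=b$ is an iteration $M_kx^{k+1}=N_kx^k+b$ with linear operators $M_k,N_k$ satisfying $A=M_k-N_k$ for all $k$, where $M_k$ is assumed to be invertible. It is called fully commuting if for all $i,j\in\mathbb N$: $M_iN_j=N_jM_i$, $M_iM_j=M_jM_i$ and $N_iN_j=N_jN_i$. *)

(* Defs.v *)
From HB Require Import structures.
From mathcomp Require Import all_boot all_order all_algebra.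
From mathcomp Require Import reals complex.

Set Implicit Arguments.
Unset Strict Implicit.
Unset Printing Implicit Defensive.

Import Order.TTheory GRing.Theory Num.Theory.
Local Open Scope ring_scope.

(* Operators act on a vector space of arbitrary dimension. They are compared
   pointwise (=1), their product is composition, and an operator is invertible
   when it is bijective (its inverse is then linear as well). *)

Section Splitting.
Variables (K : fieldType) (E : lmodType K).
Implicit Types (A : {linear E -> E}) (M N : nat -> {linear E -> E}).

Definition commuting (S T : E -> E) : Prop := S \o T =1 T \o S.

Definition splitting_scheme A M N : Prop :=
  forall k, bijective (M k) /\ A =1 M k \- N k.

Definition splitting_iterates M N (b : E) (x : nat -> E) : Prop :=
  forall k, M k (x k.+1) = N k (x k) + b.

Definition fully_commuting M N : Prop :=
  forall i j, [/\ commuting (M i) (N j), commuting (M i) (M j)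
                & commuting (N i) (N j)].

End Splitting.

Section ADI.
Variables (K : fieldType) (E : lmodType K).
Variables (H V : {linear E -> E}) (alpha beta : nat -> K).

(* xh k stands for the intermediate iterate x^{k+1/2}; the starting vector x 0
   is unconstrained. *)
Definition ADI_iterates (b : E) (x : nat -> E) : Prop :=
  exists xh : nat -> E, forall k,
    (H \+ alpha k \*: idfun) (xh k) = b - (V \- alpha k \*: idfun) (x k) /\
    (V \+ beta k \*: idfun) (x k.+1) = b - (H \- beta k \*: idfun) (xh k).

Definition ADI_M (k : nat) : {linear E -> E} :=
  (alpha k + beta k)^-1 \*:
    ((H \+ alpha k \*: idfun) \o (V \+ beta k \*: idfun)).

Definition ADI_N (k : nat) : {linear E -> E} :=
  (alpha k + beta k)^-1 \*:
    ((H \- beta k \*: idfun) \o (V \- alpha k \*: idfun)).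

End ADI.

(* Main.v *)
(** For fixed k put P = H + alpha, P' = H - beta, Q = V + beta, Q' = V - alpha
    and c = alpha + beta, so that P - P' = Q - Q' = c and
    PQ - P'Q' = c(H + V). Write u = Q x^{k+1}, v = Q' x^k, y = x^{k+1/2}: the
    half-steps are P y = b - v and u = b - P' y. Applying P to the second one
    and using P P' = P' P gives the full step P u = P' v + c b. Conversely,
    the difference of the half-steps is c y = u - v, and taking this as the
    definition of y recovers both half-steps from the full step. *)

Require Import Defs.
From HB Require Import structures.
From mathcomp Require Import all_boot all_order all_algebra.
From mathcomp Require Import reals complex.

Set Implicit Arguments.
Unset Strict Implicit.
Unset Printing Implicit Defensive.

Import Order.TTheory GRing.Theory Num.Theory.
Local Open Scope ring_scope.


Section CommutingOperators.
Variables (K : fieldType) (E : lmodType K).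
Implicit Types (S T U : {linear E -> E}) (a : K).

Lemma commuting_sym S T : commuting S T -> commuting T S.
Proof. by move=> ST x; rewrite ST. Qed.

Lemma commutingD S T U :
  commuting S U -> commuting T U -> commuting (S \+ T) U.
Proof.
by move=> SU TU x; move: (SU x) (TU x) => /= SUx TUx; rewrite linearD SUx TUx.
Qed.

Lemma commutingB S T U :
  commuting S U -> commuting T U -> commuting (S \- T) U.
Proof.
by move=> SU TU x; move: (SU x) (TU x) => /= SUx TUx; rewrite linearB SUx TUx.
Qed.

Lemma commutingZ a S U : commuting S U -> commuting (a \*: S) U.
Proof. by move=> SU x; move: (SU x) => /= SUx; rewrite linearZ SUx. Qed.

Lemma commuting_comp S T U :
  commuting S U -> commuting T U -> commuting (S \o T) U.
Proof.
by move=> SU TU x; move: (SU (T x)) (TU x) => /= SUTx TUx; rewrite TUx SUTx.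
Qed.

Lemma bijectiveZ a S : a != 0 -> bijective S -> bijective (a \*: S).
Proof.
move=> a_neq0 S_bij; apply: (@bij_comp _ _ _ (fun x : E => a *: x)) S_bij.
by exists (fun x : E => a^-1 *: x) => x; rewrite scalerA ?mulVf ?mulfV ?scale1r.
Qed.

End CommutingOperators.

Section HalfSteps.
Variables (K : fieldType) (E : lmodType K) (P P' : {linear E -> E}) (c : K).
Hypothesis PE : forall y, P y = P' y + c *: y.

(** [V] enters only through the vectors [u] and [v], so eliminating [y] concerns [P] and [P']
    alone. *)
Lemma full_step_of_half_steps b u v y :
  P y = b - v -> u = b - P' y -> P u = P' v + c *: b.
Proof.
move=> Py ->.
(* [P] and [P'] commute because they differ by the scalar [c]. *)
have -> : P (b - P' y) = P b - P' (P y).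
  by rewrite linearB (PE (P' y)) (PE y) !(linearD P') linearZ.
by rewrite Py PE linearB opprB [LHS]addrC addrA subrK.
Qed.

Lemma half_steps_of_full_step b u v :
    c != 0 -> P u = P' v + c *: b ->
  let y := c^-1 *: (u - v) in P y = b - v /\ u = b - P' y.
Proof.
move=> c_neq0 Pu y.
have cy : c *: y = u - v by rewrite scalerA mulfV ?scale1r.
(* Multiplied by [c], the left side becomes P'(u - v) + c u = P u - P' v, which is c b by the full
   step. *)
have sum_b : P' y + u = b.
  apply: (scalerI c_neq0); rewrite scalerDr -linearZ cy linearB addrAC -PE Pu.
  by rewrite addrAC subrr add0r.
split; first by rewrite PE cy addrA sum_b.
by rewrite -sum_b addrAC subrr add0r.
Qed.

End HalfSteps.

Section ADISplitting.
Variables (K : fieldType) (E : lmodType K).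
Variables (H V : {linear E -> E}) (alpha beta : nat -> K).

Local Notation M := (ADI_M H V alpha beta).
Local Notation N := (ADI_N H V alpha beta).

(** Taken with (alpha, beta) for [H] and with (beta, alpha) for [V], this yields both P - P' = c and
    Q - Q' = c. *)
Lemma shiftE (T : {linear E -> E}) (a c : K) x :
  (T \+ a \*: idfun) x = (T \- c \*: idfun) x + (a + c) *: x.
Proof. by rewrite /= scalerDl [a *: x + _]addrC addrA subrK. Qed.

Lemma scale_ADI_M k x : alpha k + beta k != 0 ->
  (alpha k + beta k) *: M k x
    = (H \+ alpha k \*: idfun) ((V \+ beta k \*: idfun) x).
Proof. by move=> c_neq0; rewrite scalerA mulfV // scale1r. Qed.

Lemma scale_ADI_N k x : alpha k + beta k != 0 ->
  (alpha k + beta k) *: N k x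
    = (H \- beta k \*: idfun) ((V \- alpha k \*: idfun) x).
Proof. by move=> c_neq0; rewrite scalerA mulfV // scale1r. Qed.

(** Telescoping gives PQ - P'Q' = P(Q - Q') + (P - P')Q' = c(P + Q'), and the shifts by [alpha k] in
    P and Q' cancel. *)
Lemma ADI_M_sub_N k : alpha k + beta k != 0 -> H \+ V =1 M k \- N k.
Proof.
move=> c_neq0 x; apply: (scalerI c_neq0).
rewrite scalerBr scale_ADI_M // scale_ADI_N //=.
have /= -> := shiftE V (beta k) (alpha k) x.
have /= HE := shiftE H (alpha k) (beta k) (V x - alpha k *: x).
rewrite (linearD H) (linearZ_LR H) [X in _ = _ + X - _]scalerDr addrACA HE.
rewrite addrAC [X in _ = X + _]addrAC subrr add0r.
rewrite [beta k + _]addrC [alpha k *: (_ *: x)]scalerA mulrC -scalerA.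
by rewrite -!scalerDr [H x + _ *: x]addrC addrA subrK [H x + V x]addrC.
Qed.

Lemma ADI_M_bijective k :
    alpha k + beta k != 0 -> bijective (H \+ alpha k \*: idfun) ->
  bijective (V \+ beta k \*: idfun) -> bijective (M k).
Proof.
move=> c_neq0 H_bij V_bij; apply: bijectiveZ; first by rewrite invr_eq0.
exact: bij_comp.
Qed.

Lemma ADI_iteratesP b x :
    (forall k, alpha k + beta k != 0) ->
  ADI_iterates H V alpha beta b x <-> splitting_iterates M N b x.
Proof.
move=> c_neq0.
have PE k := shiftE H (alpha k) (beta k).
split=> [[xh half_steps] k | full_steps].
  have [Pxh Qx] := half_steps k; apply: (scalerI (c_neq0 k)).
  rewrite scalerDr scale_ADI_M // scale_ADI_N //.
  exact: (full_step_of_half_steps (PE k) Pxh Qx).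
(* The half-steps force c y = u - v, so this is the only candidate for x^{k+1/2}. *)
exists (fun k => (alpha k + beta k)^-1 *:
  ((V \+ beta k \*: idfun) (x k.+1) - (V \- alpha k \*: idfun) (x k))) => k.
apply: (half_steps_of_full_step (PE k)) => //.
have := congr1 ( *:%R (alpha k + beta k)) (full_steps k).
by rewrite scalerDr scale_ADI_M // scale_ADI_N.
Qed.

(** [M k] and [N k] are built from [H], [V] and scalars by sums and products, so they lie in the
    algebra generated by [H] and [V]. Keeping [U] arbitrary allows the lemma to be applied to its
    own output. *)
Lemma commuting_ADI_MN (U : {linear E -> E}) k :
    commuting H U -> commuting V U -> commuting (M k) U /\ commuting (N k) U.
Proof.
move=> HU VU; have idU a : commuting (a \*: idfun) U by apply: commutingZ.
split; apply/commutingZ/commuting_comp.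
- by apply: commutingD => //; apply: idU.
- by apply: commutingD => //; apply: idU.
- by apply: commutingB => //; apply: idU.
- by apply: commutingB => //; apply: idU.
Qed.

Lemma ADI_fully_commuting : commuting H V -> fully_commuting M N.
Proof.
move=> HV i j; have VH := commuting_sym HV.
have [MjH NjH] : commuting (M j) H /\ commuting (N j) H.
  exact: commuting_ADI_MN.
have [MjV NjV] : commuting (M j) V /\ commuting (N j) V.
  exact: commuting_ADI_MN.
(* Second round: [M j] and [N j], now known to commute with [H] and [V], take the role of [U]. *)
have [MiMj _] := commuting_ADI_MN i (commuting_sym MjH) (commuting_sym MjV).
have [MiNj NiNj] := commuting_ADI_MN i (commuting_sym NjH) (commuting_sym NjV).
by split.
Qed.

End ADISplitting.

Theorem theorem3p1 (R : realType) (E : lmodType R[i])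
    (H V : {linear E -> E}) (b : E) (alpha beta : nat -> R[i])
    (alpha_beta_neq0 : forall k, alpha k + beta k != 0)
    (H_inv : forall k, bijective (H \+ alpha k \*: idfun))
    (V_inv : forall k, bijective (V \+ beta k \*: idfun))
    (HV_comm : commuting H V) :
  let A : {linear E -> E} := H \+ V in
  let M := ADI_M H V alpha beta in
  let N := ADI_N H V alpha beta in
  [/\ forall x, ADI_iterates H V alpha beta b x <-> splitting_iterates M N b x,
      splitting_scheme A M N
    & fully_commuting M N].
Proof.
split; first by move=> x; apply: ADI_iteratesP.
  move=> k; split; first exact: ADI_M_bijective.
  exact: ADI_M_sub_N.
exact: ADI_fully_commuting.
Qed.
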